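(* For every cardinal $\kappa$ with $1\le \kappa\le 2^{\omega}$ there exists a class $\mathcal{F}\subset\mathbb{R}^{\mathbb{R}}$ such that $\mathrm{sc}(\mathcal{F})=\kappa^{+}$.
   Context: $\mathbb{R}^{\mathbb{R}}$ is the set of all functions $f:\mathbb{R}\to\mathbb{R}$, and $\kappa^+$ is the successor cardinal of $\kappa$. A difference operator is a map $D:\mathbb{R}^{\mathbb{R}}\to\mathbb{R}^{\mathbb{R}}$ of the form $(Df)(x)=\sum_{i=1}^n a_i f(x+b_i)$ with $a_i,b_i\in\mathbb{R}$; $\mathcal{D}$ is the set of difference operators. A system of difference equations is a set $S\subset\mathcal{D}\times\mathbb{R}^{\mathbb{R}}$; a function $f:\mathbb{R}\to\mathbb{R}$ is a solution to $S$ if $Df=g$ for every $(D,g)\in S$. A subsystem of $S$ is a subset of $S$. For $\mathcal{F}\subset\mathbb{R}^{\mathbb{R}}$ the solvability cardinal $\mathrm{sc}(\mathcal{F})$ is the minimal cardinal $\kappa$ with the following property: for every system $S$ of difference equations, if every subsystem of $S$ of cardinality less than $\kappa$ has a solution in $\mathcal{F}$, then $S$ has a solution in $\mathcal{F}$. *)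

(* Defs.v *)
From HB Require Import structures.
From mathcomp Require Import all_boot all_order all_algebra.
From mathcomp Require Import boolp classical_sets functions cardinality reals.

Set Implicit Arguments.
Unset Strict Implicit.
Unset Printing Implicit Defensive.

Import GRing.Theory.

Local Open Scope classical_set_scope.
Local Open Scope card_scope.
Local Open Scope ring_scope.

(* A cardinal is represented by any set (on any type) of that cardinality;
   the predicates on cardinals below are invariant under [#=]. *)

Definition card_lt (T U : Type) (A : set T) (B : set U) : Prop :=
  A #<= B /\ A #!= B.

Notation "A '#<' B" := (card_lt A B)
  (at level 79, format "A  '#<'  B") : card_scope.

Definition is_succ_card (T U : Type) (K : set T) (L : set U) : Prop :=
  K #< L /\ forall (V : Type) (M : set V), K #< M -> L #<= M.

Section DifferenceEquations.
Variable R : realType.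

Definition difference_operator : set ((R -> R) -> (R -> R)) :=
  [set D | exists (n : nat) (a b : 'I_n -> R),
     forall (f : R -> R) (x : R), D f x = \sum_(i < n) a i * f (x + b i)].

Definition equation : Type := (((R -> R) -> (R -> R)) * (R -> R))%type.

Definition difference_system (S : set equation) : Prop :=
  S `<=` difference_operator `*` setT.

Definition solution (S : set equation) (f : R -> R) : Prop :=
  forall D g, S (D, g) -> D f = g.

Definition solvable_in (F : set (R -> R)) (S : set equation) : Prop :=
  exists2 f : R -> R, F f & solution S f.

Definition sc_property (F : set (R -> R)) (T : Type) (K : set T) : Prop :=
  forall S : set equation, difference_system S ->
    (forall S' : set equation, S' `<=` S -> S' #< K -> solvable_in F S') ->
    solvable_in F S.

(* [is_sc F K] says that sc(F) is the cardinality of K. *)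
Definition is_sc (F : set (R -> R)) (T : Type) (K : set T) : Prop :=
  sc_property F K /\
  forall (U : Type) (M : set U), sc_property F M -> K #<= M.

End DifferenceEquations.

(* Main.v *)
Require Import Defs.
From HB Require Import structures.
From mathcomp Require Import all_boot all_order all_algebra.
From mathcomp Require Import boolp classical_sets functions cardinality reals.
From mathcomp Require Import lra.

(** Let [B] be a set of cardinality [K] of binary sequences.  To every binary
sequence [s] one attaches a real number [prefix_real s] in such a way that the
real numbers obtained are independent: for each [s] there is an additive
subgroup of the reals that contains [prefix_real t] for all [t <> s] but does
not contain [prefix_real s].  Let [f_s] be the indicator function of this
subgroup.  Then [prefix_real t] is a period of [f_s] if and only if [s <> t],
that is, [f_s] solves the difference equation
[f (x + prefix_real t) - f x = 0] if and only if [s <> t].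

Take for F the class of all [f_s] with [s] in [B].
- The system of the equations with [t] in [B] has no solution in F, since [f_s]
  violates the equation of [s].  A subsystem of cardinality less than [K] omits
  the equation of some [s], hence is solved by [f_s].  So no cardinal up to [K]
  has the defining property of sc(F) ([not_sc_property_indicators]).
- If a system has no solution in F, choose an equation violated by [f] for
  each [f] in F; the chosen equations form a subsystem of cardinality at most
  [K] without solution in F.  So every cardinal greater than [K] has that
  property ([sc_property_card_lt]).

The successor of [K] therefore is sc(F).  Its existence, and the fact that a
cardinal that is not greater than [K] is at most [K], come from the existence
of a least cardinal in every nonempty family ([min_card_family]).

For the independence, [prefix_real s] is the sum of 1/(k+1)! over the codes [k]
of the finite prefixes of [s].  Two distinct sequences have only finitely many
common prefixes, so along the codes of the prefixes of [s] the factorial digit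
of [prefix_real s] is always 1, while that of [prefix_real t] is eventually 0.
Having a factorial digit that is eventually 0 along these codes, in a sense
that allows for a bounded error, defines the subgroup ([vanishing_digits]). *)

Set Implicit Arguments.
Unset Strict Implicit.
Unset Printing Implicit Defensive.

Import Order.TTheory GRing.Theory Num.Theory.

Local Open Scope classical_set_scope.
Local Open Scope card_scope.

(** * Comparison of cardinals *)

Lemma injective_card_le (T U : Type) (A : set T) (B : set U) (f : T -> U) :
  (forall x y, A x -> A y -> f x = f y -> x = y) ->
  (forall x, A x -> B (f x)) -> A #<= B.
Proof.
move=> f_inj f_sub.
have /card_eqPle[_ A_le] : f @` A #= A.
  by apply: inj_card_eq => x y /set_mem Ax /set_mem Ay; exact: f_inj.
apply: card_le_trans A_le _; apply: subset_card_le => _ [x Ax <-].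
exact: f_sub.
Qed.

(** Consider the sets of selections of the family in which distinct selections
differ at every index.  By Zorn's lemma there is a maximal such set [X].  At
some index [i0] the selections in [X] exhaust [A i0], for otherwise a new
selection avoiding [X] at every index could be added.  Sending [a] in [A i0] to
the value at [i] of the selection through [a] then injects [A i0] in [A i]. *)
Lemma min_card_family (I T : Type) (A : I -> set T) :
  inhabited I -> exists i0, forall i, A i0 #<= A i.
Proof.
move=> [j0].
pose P (X : set (I -> T)) :=
  (forall x, X x -> forall i, A i (x i)) /\
  (forall x y i, X x -> X y -> x i = y i -> x = y).
have [X [[X_sub X_inj] X_max]] : exists X, P X /\ forall Y, X `<` Y -> ~ P Y.
  apply: Zorn_bigcup => F FP F_tot; split.
    by move=> x [X FX Xx]; exact: (FP X FX).1.
  move=> x y i [X FX Xx] [Y FY Yy].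
  have [/(_ _ Xx) Yx|/(_ _ Yy) Xy] := F_tot X Y FX FY.
    exact: (FP Y FY).2.
  exact: (FP X FX).2.
have [i0 i0_onto] : exists i0, forall a, A i0 a -> exists2 x, X x & x i0 = a.
  apply: contrapT => no_onto.
  have fresh i : exists a, A i a /\ forall x, X x -> x i <> a.
    apply: contrapT => no_fresh; apply: no_onto; exists i => a Aa.
    apply: contrapT => no_x; apply: no_fresh; exists a; split=> // x Xx xa.
    by apply: no_x; exists x.
  have [z z_fresh] := choice fresh.
  pose Y := X `|` [set z].
  have : P Y.
    split=> [x [Xx|->] i|x y i [Xx|->] [Xy|->] // xy].
    - exact: X_sub.
    - exact: (z_fresh i).1.
    - exact: X_inj xy.
    - by case: ((z_fresh i).2 x).
    - by case: ((z_fresh i).2 y).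
  apply: (X_max Y); split; first by move=> ?; left.
  move=> /(_ z (or_intror erefl)) Xz.
  exact: (z_fresh j0).2 Xz erefl.
exists i0 => i.
have pick a : exists x, A i0 a -> X x /\ x i0 = a.
  have [/i0_onto[x Xx xa]|nAa] := pselect (A i0 a); first by exists x.
  by exists (fun=> a).
have [sel selP] := choice pick.
apply: (@injective_card_le _ _ _ _ (fun a => sel a i)).
  move=> a b Aa Ab sel_ab; have [Xa ea] := selP a Aa; have [Xb eb] := selP b Ab.
  by rewrite -ea -eb (X_inj _ _ i Xa Xb sel_ab).
by move=> a Aa; apply: X_sub; exact: (selP a Aa).1.
Qed.

Lemma card_le_total (T U : Type) (A : set T) (B : set U) :
  A #<= B \/ B #<= A.
Proof.
pose F (b : bool) : set (T + U) := if b then inl @` A else inr @` B.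
have FA : F true #= A by apply: inj_card_eq => x y _ _ [].
have FB : F false #= B by apply: inj_card_eq => x y _ _ [].
have [[] min] := min_card_family F (inhabits true).
  by left; move: (min false); rewrite (card_le_eql FA) (card_le_eqr FB).
by right; move: (min true); rewrite (card_le_eqr FA) (card_le_eql FB).
Qed.

Lemma card_lt_power (T : Type) (A : set T) : A #< [set: set T].
Proof.
split.
  apply: (@injective_card_le _ _ _ _ (fun x => [set x])) => // x y _ _ xy.
  by have : [set y] x by rewrite -xy.
apply/negP => /card_eqPle[_ le_A].
have /pcard_surjP[g g_onto] : [set: set T] #<= [set: T].
  exact: card_le_trans le_A (card_leT A).
have [x _ gx] := g_onto [set x | ~ g x x] I.
have gxP : g x x <-> ~ g x x by rewrite {1}gx.
tauto.
Qed.

Lemma card_ltNge (T U : Type) (A : set T) (B : set U) : ~ (A #< B) -> B #<= A.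
Proof.
move=> AB; have [leAB|//] := card_le_total A B.
have [eqAB|neAB] := boolP (A #= B); last by case: AB.
by move/card_eqPle : eqAB => [].
Qed.

(** The successor is the least cardinal greater than that of [K] among the
subsets of [set T].  A set of any other type is either at least as large as
[set T] or in bijection with one of these subsets. *)
Lemma exists_succ_card (T : Type) (K : set T) :
  exists L : set (set T), is_succ_card K L.
Proof.
pose I := {A : set (set T) | K #< A}.
have [[L KL] L_min] := @min_card_family I _ (@sval _ _)
  (inhabits (exist _ setT (card_lt_power K))).
exists L; split=> // V M KM.
have [le_M|/pcard_leP[f]] := card_le_total [set: set T] M.
  exact: card_le_trans (card_leT L) le_M.
have eq_M : f @` M #= M by exact: card_image.
have KfM : K #< f @` M.
  case: KM => le_KM ne_KM; split; first by rewrite (card_le_eqr eq_M).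
  by rewrite (card_eqr eq_M).
by rewrite -(card_le_eqr eq_M); exact: (L_min (exist _ _ KfM)).
Qed.

Local Open Scope ring_scope.

(** * Almost disjoint sets of codes *)

Definition prefix_digit (s : nat -> bool) (k : nat) : bool :=
  if unpickle k is Some t then t == mkseq s (size t) else false.

Definition prefix_code (s : nat -> bool) (n : nat) : nat := pickle (mkseq s n).

Lemma prefix_digit_code s n : prefix_digit s (prefix_code s n).
Proof. by rewrite /prefix_digit /prefix_code pickleK size_mkseq. Qed.

(** Almost disjointness: a prefix of [s] that extends beyond the first
disagreement with [t] is not a prefix of [t]. *)
Lemma prefix_digit_code_neq (s t : nat -> bool) : s <> t ->
  exists N, forall n, (N <= n)%N -> prefix_digit t (prefix_code s n) = false.
Proof.
move=> st.
have [m stm] : exists m, s m <> t m.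
  by apply: contrapT => /forallNP st0; apply: st; apply/funext => m;
     exact: contrapT.
exists m.+1 => n mn; rewrite /prefix_digit /prefix_code pickleK size_mkseq.
apply/eqP => /(congr1 (nth false ^~ m)).
by rewrite !nth_mkseq.
Qed.

Lemma prefix_code_unbounded s (n N : nat) :
  exists m, (n <= m)%N /\ (N <= prefix_code s m)%N.
Proof.
apply: contrapT => /forallNP bounded.
have : (N.+1 <= N)%N.
  apply: (@pigeonhole _ _ (fun i => prefix_code s (n + i))).
    move=> i j _ _ /(pcan_inj pickleK)/(congr1 size).
    by rewrite !size_mkseq => /addnI.
  move=> _ [i _ <-] /=; rewrite ltnNge; apply/negP => Ni.
  by apply: (bounded (n + i)%N); rewrite leq_addr.
by rewrite ltnn.
Qed.

(** * An independent family of reals indexed by binary sequences *)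

Section PrefixReal.
Variables (R : realType).
Implicit Types (s t : nat -> bool) (k : nat).

Definition prefix_sum s k : R :=
  \sum_(l < k) (prefix_digit s l)%:R / (l.+1)`!%:R.

Definition prefix_real s : R := sup (range (prefix_sum s)).

Lemma fact_gt0R n : 0 < n`!%:R :> R.
Proof. by rewrite ltr0n fact_gt0. Qed.

Lemma prefix_sumS s k :
  prefix_sum s k.+1 = prefix_sum s k + (prefix_digit s k)%:R / (k.+1)`!%:R.
Proof. by rewrite /prefix_sum big_ord_recr. Qed.

Lemma prefix_sum_le s k m :
  (k <= m)%N -> prefix_sum s k <= prefix_sum s m.
Proof.
elim: m => [|m IH]; first by rewrite leqn0 => /eqP ->.
rewrite leq_eqVlt => /predU1P[-> //|/IH/le_trans]; apply.
by rewrite prefix_sumS lerDl divr_ge0 ?ler0n.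
Qed.

(** The remainder after [k] terms is bounded by 2/(k+1)! because adding a term
never increases the partial sum completed by this bound. *)
Lemma prefix_sum_tail s k m :
  prefix_sum s (k + m) + 2 / (k + m).+1`!%:R <= prefix_sum s k + 2 / k.+1`!%:R.
Proof.
elim: m => [|m IH]; first by rewrite addn0.
apply: le_trans IH; rewrite addnS prefix_sumS -addrA lerD2l.
set n := (k + m)%N.
rewrite [(n.+2)`!]factS natrM.
have n1 := fact_gt0R n.+1.
have n2 : 0 < n.+2%:R :> R by rewrite ltr0n.
have d1 : (prefix_digit s n)%:R <= 1 :> R by rewrite lern1 leq_b1.
rewrite invfM mulrA -mulrDl ler_pM2r ?invr_gt0//.
have le1 : 2 / n.+2%:R <= 1 :> R by rewrite ler_pdivrMr// mul1r ler_nat.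
exact: lerD d1 le1.
Qed.

Lemma prefix_sum_bound s k m : prefix_sum s m <= prefix_sum s k + 2 / k.+1`!%:R.
Proof.
have [mk|/ltnW/subnKC <-] := leqP m k.
  apply: le_trans (prefix_sum_le s mk) _.
  by rewrite lerDl divr_ge0 ?ler0n.
apply: le_trans (prefix_sum_tail s k (m - k)%N).
by rewrite lerDl divr_ge0 ?ler0n.
Qed.

Lemma prefix_real_bounds s k :
  prefix_sum s k <= prefix_real s <= prefix_sum s k + 2 / k.+1`!%:R.
Proof.
apply/andP; split.
  apply: ub_le_sup; last by exists k.
  by exists (prefix_sum s 0 + 2 / 1`!%:R) => _ [m _ <-]; exact: prefix_sum_bound.
apply: ge_sup; first by exists (prefix_sum s 0), 0%N.
by move=> _ [m _ <-]; exact: prefix_sum_bound.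
Qed.

Lemma prefix_sum_fact_int s k : exists p : int, k`!%:R * prefix_sum s k = p%:~R.
Proof.
elim: k => [|k [p IH]].
  by exists 0; rewrite /prefix_sum big_ord0 mulr0.
exists (k.+1%:R * p + (prefix_digit s k)%:R).
rewrite prefix_sumS mulrDr mulrCA divff ?gt_eqF ?fact_gt0R// mulr1.
by rewrite factS natrM -mulrA IH rmorphD rmorphM !rmorph_nat.
Qed.

(** After multiplication by k!, the terms before the [k]-th are integers and the
terms after it are negligible against 1/(k+1), so the fractional part reveals
the [k]-th digit. *)
Lemma fact_prefix_real s k : exists p : int,
  0 <= k`!%:R * prefix_real s - p%:~R - (prefix_digit s k)%:R / k.+1%:R
    <= 2 / k.+1%:R ^+ 2.
Proof.
have [p kp] := prefix_sum_fact_int s k; exists p.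
rewrite -kp -mulrBr.
have -> : (prefix_digit s k)%:R / k.+1%:R =
    k`!%:R * ((prefix_digit s k)%:R / k.+1`!%:R) :> R.
  rewrite factS natrM invfM mulrCA; congr (_ * _).
  by rewrite mulrCA divff ?mulr1 ?gt_eqF ?fact_gt0R.
rewrite -mulrBr -addrA -opprD -prefix_sumS.
have /andP[lo hi] := prefix_real_bounds s k.+1.
apply/andP; split; first by rewrite mulr_ge0 ?ler0n ?subr_ge0.
apply: (@le_trans _ _ (k`!%:R * (2 / k.+2`!%:R))).
  by rewrite ler_wpM2l ?ler0n// lerBlDl.
rewrite !factS !natrM mulrCA ler_pM2l ?ltr0n// [k.+2%:R * _]mulrC.
have k0 := fact_gt0R k.
rewrite [_ * k`!%:R]mulrC -mulrA invfM mulrA divff ?gt_eqF// mul1r.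
by rewrite expr2 lef_pV2 ?posrE ?mulr_gt0 ?ltr0n// ler_wpM2l ?ler0n// ler_nat.
Qed.

(** The reals [x] whose [k]-th factorial digit vanishes for almost all codes [k]
of prefixes of [s].  A digit 1 puts k! x at distance about 1/(k+1) from an
integer, so a distance of order 1/(k+1)^2 expresses a digit 0; leaving the
constant free makes the condition stable under addition.  The same [C] serves
as error constant and as threshold, which is no restriction as both may be
increased. *)
Definition vanishing_digits s : set R := [set x | exists C : nat, forall n,
  (C <= n)%N -> let k := prefix_code s n in
  exists p : int, `|k`!%:R * x - p%:~R| <= C%:R / k.+1%:R ^+ 2].

Lemma vanishing_digits0 s : vanishing_digits s 0.
Proof.
exists 0%N => n _ /=; exists 0.
by rewrite mulr0 subr0 normr0 mul0r.
Qed.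

Lemma vanishing_digitsN s x : vanishing_digits s x -> vanishing_digits s (- x).
Proof.
move=> [C xC]; exists C => n Cn /=; have [p xp] := xC n Cn; exists (- p).
by rewrite mulrN rmorphN -opprD normrN.
Qed.

Lemma vanishing_digitsD s x y :
  vanishing_digits s x -> vanishing_digits s y -> vanishing_digits s (x + y).
Proof.
move=> [C xC] [D yD]; exists (C + D)%N => n CDn /=.
have [p xp] := xC n (leq_trans (leq_addr _ _) CDn).
have [q yq] := yD n (leq_trans (leq_addl _ _) CDn).
exists (p + q); rewrite mulrDr rmorphD opprD addrACA natrD mulrDl.
by apply: le_trans (ler_normD _ _) _; exact: lerD.
Qed.

(** The threshold [N + 2] also serves as error constant, and the error in
[fact_prefix_real] has constant 2. *)
Lemma vanishing_digits_prefix_real s t :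
  s <> t -> vanishing_digits s (prefix_real t).
Proof.
move=> /prefix_digit_code_neq[N tN]; exists (N + 2)%N => n Nn /=.
have [p] := fact_prefix_real t (prefix_code s n).
rewrite tN ?(leq_trans (leq_addr _ _) Nn)// mul0r subr0 => /andP[lo hi].
exists p; rewrite ger0_norm//; apply: le_trans hi _.
by rewrite ler_pM2r ?invr_gt0 ?exprn_gt0 ?ltr0n// ler_nat leq_addl.
Qed.

(** The fractional part of k! times this real lies between 1/(k+1) and 3/(k+1)
for all codes [k] of prefixes of [s]; once [k] is at least [C + 3], this is too
far from the integers on both sides. *)
Lemma not_vanishing_digits_prefix_real s : ~ vanishing_digits s (prefix_real s).
Proof.
move=> [C sC]; have [n [Cn Ck]] := prefix_code_unbounded s C (C + 3).
have [q] := sC n Cn; have [p] := fact_prefix_real s (prefix_code s n).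
rewrite prefix_digit_code /=; set x := _ * prefix_real s.
move: Ck; set k := prefix_code s n => Ck.
set h : R := k.+1%:R^-1.
have Ch : (C%:R + 3) * h < 1.
  by rewrite ltr_pdivrMr ?ltr0n// mul1r -(natrD _ _ 3) ltr_nat ltnS.
have h0 : 0 < h by rewrite invr_gt0 ltr0n.
have C0 : 0 <= C%:R :> R by rewrite ler0n.
rewrite -exprVn mul1r -/h => /andP[lo hi]; rewrite ler_distl => /andP[ql qh].
have Chh : (C%:R + 3) * h ^+ 2 < h by rewrite expr2 mulrA gtr_pMl.
have hh0 : 0 <= h ^+ 2 by rewrite sqr_ge0.
have Chh0 : 0 <= C%:R * h ^+ 2 by rewrite mulr_ge0.
have Ch0 : 0 <= C%:R * h by rewrite mulr_ge0 // ltW.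
(* [q] is greater than [p] since x - p >= h > C h^2, and less than [p + 1]
   since x - p <= h + 2 h^2. *)
have : (p < q)%R by rewrite -(ltr_int R); nra.
rewrite -lezD1 -(ler_int R) rmorphD /= rmorph1; nra.
Qed.

End PrefixReal.

(** * Indicator functions with prescribed periods *)

Section PeriodicIndicators.
Variable R : realType.
Implicit Types s t : nat -> bool.

Definition vanishing_indicator s (x : R) : R := `[< vanishing_digits s x >]%:R.

Definition period_equation t : equation R :=
  (fun f x => f (x + prefix_real R t) - f x, fun=> 0).

Lemma period_equation_difference t :
  difference_operator (period_equation t).1.
Proof.
exists 2%N, (fun i => if val i == 0%N then 1 else -1),
  (fun i => if val i == 0%N then prefix_real R t else 0) => f x.
by rewrite !big_ord_recl big_ord0 /= addr0 mul1r mulN1r addr0.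
Qed.

(** For [s = t] the equation fails at [x = 0], as 0 lies in the subgroup while
[prefix_real s] does not; for [s <> t] the shift is by an element of the
subgroup, which preserves its indicator. *)
Lemma vanishing_indicator_solves s t :
  (period_equation t).1 (vanishing_indicator s) = (period_equation t).2 <->
  s <> t.
Proof.
split=> [/(congr1 (@^~ 0)) /= + st|st].
  rewrite -st add0r /vanishing_indicator asboolF; last first.
    exact: not_vanishing_digits_prefix_real.
  rewrite asboolT; last exact: vanishing_digits0.
  by move/eqP; rewrite sub0r oppr_eq0 oner_eq0.
apply/funext => x /=; apply/eqP; rewrite subr_eq0; apply/eqP.
have Ht := @vanishing_digits_prefix_real R s t st.
congr (nat_of_bool _)%:R; apply: asbool_equiv_eq; split=> [xt|sx].
  rewrite -[x](addrK (prefix_real R t)).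
  exact: vanishing_digitsD (vanishing_digitsN Ht).
exact: vanishing_digitsD.
Qed.

Lemma period_equation_inj : injective period_equation.
Proof.
move=> s t st; apply: contrapT => /[dup] /(vanishing_indicator_solves s t).
by rewrite -st => /vanishing_indicator_solves.
Qed.

End PeriodicIndicators.

(** * Bounds for the solvability cardinal *)

(** An unsolvable system contains an unsolvable subsystem no larger than [F]:
choose one violated equation for each function in [F]. *)
Lemma sc_property_card_lt (R : realType) (F : set (R -> R)) (U : Type)
  (L : set U) : F #< L -> sc_property F L.
Proof.
move=> [le_FL ne_FL] S Sdiff small; apply: contrapT => unsolvable.
have violated f : exists e : equation R, F f -> S e /\ e.1 f <> e.2.
  have [Ff|nFf] := pselect (F f); last by exists (id, id).
  apply: contrapT => /forallNP no_e; apply: unsolvable; exists f => // D g SDg.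
  by apply: contrapT => Dfg; apply: (no_e (D, g)).
have [e eP] := choice violated.
have [||f Ff fsol] := small (e @` F).
- by move=> _ [f Ff <-]; exact: (eP f Ff).1.
- split; first exact: card_le_trans (card_image_le e F) le_FL.
  apply/negP => /card_eqPle[_ le_LS]; move/negP : ne_FL; apply.
  apply/card_eqPle; split=> //.
  exact: card_le_trans le_LS (card_image_le e F).
have := (eP f Ff).2; apply.
by apply: fsol; rewrite -surjective_pairing; exists f.
Qed.

(** The witness is the system of all period equations of [B]: since [t] is
determined by its equation, a subsystem smaller than [B] omits the equation of
some [s] in [B], and the indicator of [s] solves all the others. *)
Lemma not_sc_property_indicators (R : realType) (B : set (nat -> bool))
    (U : Type) (M : set U) :
  M #<= B -> ~ sc_property (@vanishing_indicator R @` B) M.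
Proof.
move=> le_MB scM.
have [||_ [s Bs <-] /(_ _ _ (ex_intro2 _ _ s Bs erefl))] :=
    scM (@period_equation R @` B).
- move=> _ [t Bt <-]; split=> //; exact: period_equation_difference.
- move=> S' S'sub [le_S'M ne_S'M].
  have [s Bs S's] : exists2 s, B s & ~ S' (period_equation R s).
    apply: contrapT => noS; move/negP: ne_S'M; apply.
    apply/card_eqPle; split=> //; apply: card_le_trans le_MB _.
    apply: (@injective_card_le _ _ _ _ (@period_equation R)).
      by move=> s t _ _ /period_equation_inj.
    by move=> s Bs; apply: contrapT => nS's; apply: noS; exists s.
  exists (vanishing_indicator s); first by exists s.
  move=> D g /[dup] S'e /S'sub[t Bt e_t].
  have := (vanishing_indicator_solves R s t).2; rewrite e_t; apply => st.
  by apply: S's; rewrite st e_t.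
by move/vanishing_indicator_solves.
Qed.

Theorem theorem1p9 (R : realType) (T : Type) (K : set T)
    (K_ge1 : `I_1 #<= K) (K_le_continuum : K #<= [set: nat -> bool]) :
  exists F : set (R -> R),
  exists (U : Type) (L : set U), is_succ_card K L /\ is_sc F L.
Proof.
have /pcard_injP[h h_inj] := K_le_continuum.
have hK : h @` K #= K := inj_card_eq h_inj.
have [L KL] := exists_succ_card K.
exists (@vanishing_indicator R @` (h @` K)), (set T), L; split=> //.
have [[le_KL ne_KL] L_min] := KL.
split.
  apply: sc_property_card_lt; split.
    apply: card_le_trans (card_image_le _ _) _.
    by rewrite (card_le_eql hK).
  apply/negP => /card_eqPle[_ le_LF]; move/negP: ne_KL; apply.
  apply/card_eqPle; split=> //; apply: card_le_trans le_LF _.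
  by apply: card_le_trans (card_image_le _ _) _; rewrite (card_le_eql hK).
move=> U M scM; apply: L_min; apply: contrapT => /card_ltNge le_MK.
by apply: not_sc_property_indicators scM; rewrite (card_le_eqr hK).
Qed.
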